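(* Let $\Lambda$ be a left hereditary ring. Then $\Lambda$ is a QF-$3^{+}$ ring if and only if its maximal left ring of quotients $Q^{l}_{max}(\Lambda)$ is a semisimple ring and is projective as a left $\Lambda$-module.
   Context: Rings are associative with identity. A ring $\Lambda$ is left QF-$3^{+}$ if the injective envelope $I({}_\Lambda\Lambda)$ of the left module ${}_\Lambda\Lambda$ is projective; for left hereditary rings this notion is left-right symmetric, so one says simply QF-$3^{+}$. A ring is semisimple if all its left modules are semisimple (equivalently, projective). $Q^{l}_{max}(\Lambda)$ is the maximal left ring of quotients of Utumi: with $E=I({}_\Lambda\Lambda)\supseteq\Lambda$, it is the left $\Lambda$-submodule $\{x\in E: h(x)=0 \text{ for all } h\in \operatorname{End}_\Lambda(E) \text{ with } h(\Lambda)=0\}$ equipped with its unique ring structure extending the left $\Lambda$-module structure; it contains $\Lambda$ as a subring, and its $\Lambda$-module structures are those given by this inclusion. *)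

(* Defs.v *)
From HB Require Import structures.
From mathcomp Require Import all_boot all_order all_algebra.
From mathcomp Require Import all_classical.

Set Implicit Arguments.
Unset Strict Implicit.
Unset Printing Implicit Defensive.

Import GRing.Theory Num.Theory.
Local Open Scope ring_scope.

(* Rings are [pzRingType] (associative with 1, the zero ring allowed), left
   modules are [lmodType], the left regular module is [R^o], and submodules
   are [submodClosed] predicates.  These predicates are boolean, but boolp
   makes every Prop-valued predicate boolean, so they cover all submodules. *)

Section LinearOf.
Variables (R : pzRingType) (U V : lmodType R) (f : U -> V) (lf : linear f).
Definition linear_fun of linear f := f.
HB.instance Definition _ :=
  GRing.isLinear.Build R U V *:%R (linear_fun lf) lf.
Definition linear_of : {linear U -> V} := linear_fun lf.
End LinearOf.

Section SubmodOf.
Variables (R : pzRingType) (V : lmodType R) (P : V -> Prop).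
Definition submod_Prop := P 0 /\ forall a u v, P u -> P v -> P (a *: u + v).
Definition submod_fun of submod_Prop := fun x : V => `[< P x >].
Variable hP : submod_Prop.
Fact submod_fun_closed : subsemimod_closed (submod_fun hP).
Proof.
case: hP => P0 Pl; split; first split.
- exact/asboolP.
- by move=> u v /asboolP Pu /asboolP Pv; apply/asboolP; rewrite -[u]scale1r; exact: Pl.
- by move=> a u /asboolP Pu; apply/asboolP; rewrite -[_ *: _]addr0; exact: Pl.
Qed.
HB.instance Definition _ :=
  GRing.isSubmodClosed.Build R V (submod_fun hP) submod_fun_closed.
Definition submod_of : submodClosed V := GRing.SubmodClosed.clone R V (submod_fun hP) _.
Lemma submod_ofP x : reflect (P x) (x \in submod_of).
Proof. exact: asboolP. Qed.
End SubmodOf.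

Section SubmodType.
Variables (R : pzRingType) (V : lmodType R) (S : submodClosed V).
Record submodType := Submod { submod_val :> V; _ : submod_val \in S }.
HB.instance Definition _ := [isSub for submod_val].
HB.instance Definition _ := [Choice of submodType by <:].
HB.instance Definition _ := [SubChoice_isSubLmodule of submodType by <:].
End SubmodType.

Definition projective_module (R : pzRingType) (P : lmodType R) : Prop :=
  forall (A B : lmodType R) (g : {linear A -> B}) (h : {linear P -> B}),
    (forall b, exists a, g a = b) ->
    exists k : {linear P -> A}, forall x, g (k x) = h x.

Definition injective_module (R : pzRingType) (E : lmodType R) : Prop :=
  forall (A B : lmodType R) (f : {linear A -> B}) (g : {linear A -> E}),
    injective f -> exists h : {linear B -> E}, forall a, h (f a) = g a.

Definition semisimple_module (R : pzRingType) (M : lmodType R) : Prop :=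
  forall S : submodClosed M, exists T : submodClosed M,
    (forall x, x \in S -> x \in T -> x = 0) /\
    (forall x, exists s t, [/\ s \in S, t \in T & x = s + t]).

Definition semisimple_ring (R : pzRingType) : Prop :=
  forall M : lmodType R, semisimple_module M.

Definition left_hereditary (R : pzRingType) : Prop :=
  forall I : submodClosed R^o, projective_module (submodType I).

Definition essential_mono (R : pzRingType) (M E : lmodType R)
    (i : {linear M -> E}) : Prop :=
  injective i /\
  forall N : submodClosed E, (exists2 x, x \in N & x != 0) ->
    exists m, i m \in N /\ i m != 0.

Record injEnvelope (R : pzRingType) (M : lmodType R) := InjEnvelope {
  env_sort :> lmodType R;
  env_map : {linear M -> env_sort};
  env_essential : essential_mono env_map;
  env_injective : injective_module env_sort }.

Section Qmax.
Variables (R : pzRingType) (E : injEnvelope R^o).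
Local Notation i := (env_map E).

Definition Qmax_pred (x : E) : Prop :=
  forall h : {linear E -> E}, (forall a : R, h (i a) = 0) -> h x = 0.

Lemma Qmax_pred_submod : submod_Prop Qmax_pred.
Proof.
split=> [h _|a u v Qu Qv h hR]; first exact: linear0.
by rewrite linearP Qu // Qv // scaler0 addr0.
Qed.

Definition Qmax_submod : submodClosed E := submod_of Qmax_pred_submod.

Definition Qmax_of : Type := submodType Qmax_submod.
HB.instance Definition _ := SubChoice.on Qmax_of.
HB.instance Definition _ := GRing.Lmodule.on Qmax_of.

Implicit Types x y z : Qmax_of.

Lemma QmaxP x : Qmax_pred (val x).
Proof. exact/asboolP/(valP x). Qed.

Lemma Qmax_ext_eq (g g' : {linear E -> E}) x :
  g (i 1) = g' (i 1) -> g (val x) = g' (val x).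
Proof.
move=> gg'; apply/eqP; rewrite -subr_eq0; apply/eqP.
apply: (QmaxP x (h := (g \- g' : {linear E -> E}))) => a /=.
have -> : a = a *: (1 : R^o) by rewrite /GRing.scale /= mulr1.
by rewrite !linearZ /= gg' scalerN subrr.
Qed.

(* Right multiplication by y : the restriction to Qmax of any endomorphism of
   E sending 1 to y; by [Qmax_ext_eq] the choice does not matter. *)
Lemma Qmax_rmul_ex y : exists g : {linear E -> E}, g (i 1) = val y.
Proof.
have lf : linear (fun a : R^o => (a : R) *: val y).
  by move=> a u v; rewrite scalerDl scalerA.
have [h hP] := env_injective (linear_of lf) (env_essential E).1.
exists h; rewrite hP; exact: scale1r.
Qed.

Definition Qmax_rmul y : {linear E -> E} := projT1 (cid (Qmax_rmul_ex y)).

Lemma Qmax_rmul1 y : Qmax_rmul y (i 1) = val y.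
Proof. exact: (projT2 (cid (Qmax_rmul_ex y))). Qed.

Lemma Qmax_rmul_in x y : Qmax_rmul y (val x) \in Qmax_submod.
Proof.
apply/submod_ofP => h hR.
apply: (QmaxP x (h := (h \o Qmax_rmul y : {linear E -> E}))) => a /=.
have -> : a = a *: (1 : R^o) by rewrite /GRing.scale /= mulr1.
by rewrite !linearZ /= Qmax_rmul1 (QmaxP y) // scaler0.
Qed.

Definition Qmax_mul x y : Qmax_of := Submod (Qmax_rmul_in x y).

Fact Qmax_one_in : i 1 \in Qmax_submod.
Proof. by apply/submod_ofP => h hR; exact: hR. Qed.

Definition Qmax_one : Qmax_of := Submod Qmax_one_in.

Lemma Qmax_mulE x y (g : {linear E -> E}) :
  g (i 1) = val y -> val (Qmax_mul x y) = g (val x).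
Proof. by move=> gy; apply: Qmax_ext_eq; rewrite Qmax_rmul1. Qed.

Fact Qmax_mulA : associative Qmax_mul.
Proof.
move=> x y z; apply: val_inj.
rewrite (@Qmax_mulE _ _ (Qmax_rmul z \o Qmax_rmul y)) //=.
by rewrite Qmax_rmul1.
Qed.

Fact Qmax_mul1x : left_id Qmax_one Qmax_mul.
Proof. by move=> x; apply: val_inj; rewrite /= Qmax_rmul1. Qed.

Fact Qmax_mulx1 : right_id Qmax_one Qmax_mul.
Proof. by move=> x; apply: val_inj; rewrite (@Qmax_mulE _ _ idfun). Qed.

Fact Qmax_mulDl : left_distributive Qmax_mul +%R.
Proof. by move=> x y z; apply: val_inj; rewrite /= linearD. Qed.

Fact Qmax_mulDr : right_distributive Qmax_mul +%R.
Proof.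
move=> x y z; apply: val_inj.
by rewrite (@Qmax_mulE _ _ (Qmax_rmul y \+ Qmax_rmul z)) //= !Qmax_rmul1.
Qed.

HB.instance Definition _ := GRing.Zmodule_isPzRing.Build Qmax_of
  Qmax_mulA Qmax_mul1x Qmax_mulx1 Qmax_mulDl Qmax_mulDr.

Fact Qmax_scaleAl (a : R) x y : a *: (x * y) = (a *: x) * y.
Proof. by apply: val_inj; rewrite /= linearZ. Qed.

Fact Qmax_inj_in (a : R) : i a \in Qmax_submod.
Proof. by apply/submod_ofP => h hR; exact: hR. Qed.

Definition Qmax_inj (a : R) : Qmax_of := Submod (Qmax_inj_in a).

Lemma Qmax_inj_injective : injective Qmax_inj.
Proof. by move=> a b /(congr1 val) /= /(env_essential E).1. Qed.

Fact Qmax_inj_zmod : zmod_morphism Qmax_inj.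
Proof. by move=> a b; apply: val_inj; rewrite /= linearB. Qed.

Lemma Qmax_scaleE (a : R) x : a *: x = Qmax_inj a * x.
Proof.
have -> : Qmax_inj a = a *: (1 : Qmax_of).
  by apply: val_inj; rewrite /= -linearZ /GRing.scale /= mulr1.
by rewrite -Qmax_scaleAl mul1r.
Qed.

Fact Qmax_inj_monoid : monoid_morphism Qmax_inj.
Proof.
split=> [|a b]; first exact: val_inj.
by rewrite -Qmax_scaleE; apply: val_inj; rewrite /= -linearZ.
Qed.

HB.instance Definition _ :=
  GRing.isZmodMorphism.Build R Qmax_of Qmax_inj Qmax_inj_zmod.
HB.instance Definition _ :=
  GRing.isMonoidMorphism.Build R Qmax_of Qmax_inj Qmax_inj_monoid.

Lemma Qmax_mul_unique (mul : Qmax_of -> Qmax_of -> Qmax_of) :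
    associative mul -> left_distributive mul +%R -> left_id Qmax_one mul ->
    (forall (a : R) x, mul (Qmax_inj a) x = a *: x) ->
  forall x y, mul x y = x * y.
Proof.
move=> mA mD m1 mR x y.
have lf : linear (fun z : Qmax_of => val (mul z y)).
  by move=> a u v; rewrite mD -mR -mA mR.
have lv : linear (fun z : Qmax_of => val z) by [].
have [h hP] := env_injective (f := linear_of lv) (linear_of lf) val_inj.
have {}hP z : h (val z) = val (mul z y) by exact: hP.
apply: val_inj; rewrite -hP; apply/esym/Qmax_mulE.
by rewrite -[i 1]/(val Qmax_one) hP m1.
Qed.
End Qmax.

(* Existence of injective envelopes: Baer's criterion; Hom_Z(R, (Q/Z)^T) is
   injective and, for T = Hom_Z(M, Q/Z), contains M; a maximal essential
   extension of M inside an injective module is a direct summand of it. *)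

Local Open Scope classical_set_scope.

Lemma Zorn_set (T : Type) (P : set (set T)) (X0 : set T) :
  P X0 ->
  (forall F : set (set T), F `<=` P -> total_on F subset -> F !=set0 ->
    P (\bigcup_(X in F) X)) ->
  exists A, P A /\ forall B, A `<=` B -> P B -> B = A.
Proof.
move=> PX0 chainP.
have [|A [PA Amax]] := @Zorn_bigcup T (fun X => X = set0 \/ P X).
  move=> F FP Ftot.
  have [[X [FX /eqP X0']]|noX] := pselect (exists X, F X /\ X != set0); last first.
    left; apply/seteqP; split=> // x [X FX Xx].
    by apply: noX; exists X; split=> //; apply/set0P; exists x.
  right; rewrite [X in P X](_ : _ = \bigcup_(X in [set X | F X /\ P X]) X).
    apply: chainP => [Y []|Y Z [FY _] [FZ _]|] //; first exact: Ftot.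
    by exists X; split=> //; have [] := FP _ FX.
  apply/seteqP; split=> x [Y FY Yx]; last by exists Y => //; case: FY.
  exists Y => //; split=> //; have [Y0|//] := FP _ FY.
  by rewrite Y0 in Yx.
exists (if `[< P A >] then A else X0); case: asboolP => [{}PA|nPA].
  split=> // B AB PB; apply: contrapT => BA; apply: (Amax B); last by right.
  by split=> // BA'; apply: BA; apply/seteqP.
case: PA => // A0; split=> // B XB PB; apply/seteqP; split=> // x Bx.
by exfalso; apply: (Amax B); [rewrite A0; split=> // /(_ x Bx)|right].
Qed.

Lemma baer (R : pzRingType) (E : lmodType R) :
  (forall (I : submodClosed R^o) (f : {linear submodType I -> E}),
     exists x : E, forall r : submodType I, f r = (val r : R) *: x) ->
  injective_module E.
Proof.
move=> extE A B f g finj.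
pose good (G : set (B * E)) :=
  [/\ forall a, G (f a, g a),
      forall (r : R) b e b' e', G (b, e) -> G (b', e') ->
        G (r *: b + b', r *: e + e') &
      forall e, G (0, e) -> e = 0].
have [||G [[Gfg Gl G0] Gmax]] := @Zorn_set _ good [set (f a, g a) | a in setT].
- split=> [a|r b e b' e' [a _ [<- <-]] [a' _ [<- <-]]|e [a _ [fa <-]]].
  + by exists a.
  + by exists (r *: a + a'); rewrite // !linearP.
  + by rewrite (finj a 0) ?linear0.
- move=> F Fgood Ftot [X0 FX0]; split=> [a|r b e b' e' [X FX Xb] [Y FY Yb]|e].
  + by exists X0 => //; have [] := Fgood _ FX0.
  + have [XY|YX] := Ftot _ _ FX FY.
      by exists Y => //; have [_ + _] := Fgood _ FY; apply=> //; exact: XY.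
    by exists X => //; have [_ + _] := Fgood _ FX; apply=> //; exact: YX.
  + by case=> X FX X0e; have [_ _] := Fgood _ FX; apply.
have G00 : G (0, 0) by have := Gfg 0; rewrite !linear0.
have Gfun b e e' : G (b, e) -> G (b, e') -> e = e'.
  move=> Ge Ge'; have := Gl (-1) _ _ _ _ Ge Ge'.
  by rewrite !scaleN1r addNr => /G0 /eqP; rewrite addrC subr_eq0 => /eqP.
have Gtot b : exists e, G (b, e).
  pose P (r : R^o) := exists e, G ((r : R) *: b, e).
  have hP : submod_Prop P.
    split; first by exists 0; rewrite scale0r.
    move=> a u v [e Ge] [e' Ge']; exists (a *: e + e').
    by rewrite scalerDl -scalerA; exact: Gl.
  pose I := submod_of hP.
  have fP (r : submodType I) : {e | G ((val r : R) *: b, e)}.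
    by apply: cid; apply/submod_ofP: (valP r).
  have lf : linear (fun r => projT1 (fP r)).
    move=> a u v; apply: (@Gfun ((val (a *: u + v) : R) *: b)).
      exact: (projT2 (fP (a *: u + v))).
    rewrite /= scalerDl -scalerA.
    by apply: Gl; [exact: (projT2 (fP u))|exact: (projT2 (fP v))].
  have [x xP] := extE I (linear_of lf).
  have Px (r : R) e : G (r *: b, e) -> e = r *: x.
    move=> Gr; have rI : (r : R^o) \in I by apply/submod_ofP; exists e.
    rewrite -(xP (Submod rI)); apply: (Gfun _ _ _ Gr).
    exact: (projT2 (fP (Submod rI))).
  pose G' := [set z : B * E | exists b' e' (r : R),
    G (b', e') /\ z = (b' + r *: b, e' + r *: x)].
  have GG' : G `<=` G'.
    by move=> [b' e'] Gb; exists b', e', 0; rewrite !scale0r !addr0.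
  exists x; rewrite -(Gmax G' GG'); first by exists 0, 0, 1; rewrite !scale1r !add0r.
  split=> [a|r _ _ _ _ [b1 [e1 [r1 [G1 [-> ->]]]]] [b2 [e2 [r2 [G2 [-> ->]]]]]|e].
  + exact/GG'.
  + exists (r *: b1 + b2), (r *: e1 + e2), (r * r1 + r2); split; first exact: Gl.
    congr pair; by rewrite scalerDl -scalerA scalerDr addrACA.
  + case=> b1 [e1 [r1 [G1 [/eqP + ->]]]]; rewrite eq_sym addr_eq0 => /eqP b1E.
    have := Gl (-1) _ _ _ _ G1 G00; rewrite !addr0 !scaleN1r b1E opprK => /Px.
    by move=> <-; rewrite subrr.
have lh : linear (fun b => projT1 (cid (Gtot b))).
  move=> a u v; apply: (@Gfun (a *: u + v)); first exact: (projT2 (cid (Gtot _))).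
  by apply: Gl; [exact: (projT2 (cid (Gtot u)))|exact: (projT2 (cid (Gtot v)))].
exists (linear_of lh) => a; apply: (@Gfun (f a)) => //.
exact: (projT2 (cid (Gtot (f a)))).
Qed.

Definition divisible_group (D : zmodType) :=
  forall (d : D) (n : nat), (0 < n)%N -> exists e, e *+ n = d.

Lemma divisible_injective (D : zmodType) :
  divisible_group D -> injective_module (zmodule D).
Proof.
move=> divD; apply: baer => I f.
have [[n [n0 nI]]|noI] := pselect (exists n : nat, (0 < n)%N /\ (n%:Z : int^o) \in I).
  have ex : exists n : nat, (0 < n)%N && ((n%:Z : int^o) \in I).
    by exists n; rewrite n0.
  case: (ex_minnP ex) => {n0 nI}{}n /andP[n0 nI] nmin.
  have [e eP] := divD (f (Submod nI)) n n0.
  exists e => -[r rI].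
  have rE : r = (r %/ n)%Z *: (n%:Z : int^o).
    rewrite [LHS](divz_eq r n); set m := (r %% n)%Z.
    have mI : (m : int^o) \in I.
      have -> : m = - (r %/ n)%Z *: (n%:Z : int^o) + r.
        by rewrite [X in _ + X](divz_eq r n) /GRing.scale /= mulNr addKr.
      by rewrite rpredD // rpredZ.
    have : (0 <= m)%R by rewrite modz_ge0 // -lt0n.
    have : (m < n)%R by rewrite ltz_pmod.
    case: (m) mI => // k kI; rewrite ltz_nat => kn _.
    case: k kI kn => [_ _|k kI kn]; first by rewrite addr0.
    by have := nmin k.+1; rewrite kI => /(_ isT); rewrite leqNgt kn.
  have -> : Submod rI = (r %/ n)%Z *: Submod nI by apply: val_inj; exact: rE.
  by rewrite linearZ /= -eP; exact: (scalerA (r %/ n)%Z n%:Z (e : zmodule D)).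
exists 0 => -[r rI]; rewrite scaler0.
suff r0 : r = 0.
  have -> : Submod rI = 0 by exact: val_inj.
  by rewrite linear0.
apply: contrapT => /eqP r0; apply: noI; exists `|r|%N; rewrite absz_gt0; split=> //.
case: (r) rI => k kI //=.
by have := rpredZ (-1 : int) kI; rewrite scaleN1r.
Qed.

Definition rat_Z : zmodClosed rat := GRing.ZmodClosed.clone rat (@Num.int_num_subdef rat) _.
Local Notation QZ := (Quotient.quot rat_Z).
Local Notation piQZ x := (\pi_QZ x)%qT.

Lemma QZ_divisible : divisible_group QZ.
Proof.
move=> d n n0; exists (piQZ (repr d / n%:R)).
have dn : repr d / n%:R *+ n = repr d :> rat.
  by rewrite -mulr_natr divfK // pnatr_eq0 -lt0n.
by rewrite -raddfMn dn; exact: reprK.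
Qed.

Lemma piQZ_eq0 (c : rat) : (piQZ c == 0 :> QZ) = (c \is a Num.int).
Proof.
have -> : (0 : QZ) = piQZ 0 by rewrite raddf0.
by rewrite -[LHS]Quotient.idealrBE subr0.
Qed.

Lemma QZ_cogenerator (M : zmodType) (m : M) :
  m != 0 -> exists chi : {additive M -> QZ}, chi m != 0.
Proof.
move=> m0.
have [c [cZ cP]] : exists c : rat, c \isn't a Num.int /\
    forall k : int, m *~ k = 0 -> c * k%:~R \is a Num.int.
  have [ex|noex] := pselect (exists n, (0 < n)%N && (m *+ n == 0)); last first.
    exists (2%:R^-1); split=> // k mk.
    suff -> : k = 0 by rewrite mulr0.
    apply: contrapT => /eqP k0; apply: noex; exists `|k|%N.
    rewrite absz_gt0 k0 /=; case: (k) mk => j /= mj; first by rewrite -mj.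
    by move/eqP: mj; rewrite NegzE mulrNz oppr_eq0.
  case: (ex_minnP ex) => n /andP[n0 /eqP mn] nmin.
  have n0' : (n%:R : rat) != 0 by rewrite pnatr_eq0 -lt0n.
  exists (n%:R^-1); split.
    apply/negP => /intrP[j jE].
    have : (1 : rat) = (j * n%:Z)%:~R by rewrite intrM -jE mulVf.
    move=> /(@intr_inj rat 1) /esym/eqP.
    rewrite mulrC; case: n n0 mn nmin {n0' jE} => // -[_|n _ _ _ /eqP nj].
      by move/eqP; rewrite mulr1n (negPf m0).
    have /(congr1 absz) := nj; rewrite abszM /=.
    by move/eqP; rewrite muln_eq1.
  move=> k mk; have /dvdzP[q ->] : (n %| k)%Z.
    apply/dvdz_mod0P; set r := (k %% n)%Z.
    have mr : m *~ r = 0.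
      have -> : r = k - (k %/ n)%Z * n by apply/eqP; rewrite eq_sym subr_eq addrC -divz_eq.
      by rewrite mulrzBr mk mulrC mulrzA -pmulrn mn mul0rz subr0.
    have : (0 <= r)%R by rewrite modz_ge0 // -lt0n.
    have : (r < n)%R by rewrite ltz_pmod.
    case: (r) mr => [[|j] mj jn _|//] //.
    have := nmin j.+1; rewrite /= pmulrn mj eqxx => /(_ isT) nj.
    by move: jn; rewrite ltz_nat ltnNge nj.
  by rewrite intrM mulrCA mulVf // mulr1.
pose P (x : zmodule M) := exists k : int, x = m *~ k.
have hP : submod_Prop P.
  split; first by exists 0.
  by move=> a _ _ [k ->] [l ->]; exists (k * a + l); rewrite mulrzDr mulrzA.
have kP (x : submodType (submod_of hP)) : {k : int | val x = m *~ k}.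
  by apply: cid; apply/submod_ofP: (valP x).
pose f0 x : zmodule QZ := piQZ (c * (projT1 (kP x))%:~R).
have f0E (x : submodType (submod_of hP)) k : val x = m *~ k -> f0 x = piQZ (c * k%:~R) :> QZ.
  move=> xk; apply/eqP; rewrite -subr_eq0 -raddfB piQZ_eq0 -mulrBr -intrB.
  by apply: cP; rewrite mulrzBr -xk -(projT2 (kP x)) subrr.
have lf : linear f0.
  move=> a u v; rewrite (f0E _ (projT1 (kP u) * a + projT1 (kP v))).
    by rewrite intrD mulrDr raddfD intrM mulrA mulrzr raddfMz.
  rewrite mulrzDr mulrzA -!(projT2 (kP _)) //.
have lv : linear (fun x : submodType (submod_of hP) => val x) by [].
have [h hE] := divisible_injective QZ_divisible (f := linear_of lv)
  (linear_of lf) val_inj.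
have ah : zmod_morphism (h : M -> QZ) by move=> x y; exact: (linearB h).
pose chi : {additive M -> QZ} :=
  HB.pack (h : M -> QZ) (GRing.isZmodMorphism.Build _ _ _ ah).
exists chi; rewrite /=.
have mS : (m : zmodule M) \in submod_of hP by apply/submod_ofP; exists 1.
have -> : h m = f0 (Submod mS) by exact: (hE (Submod mS)).
by rewrite (f0E _ 1) // mulr1 piQZ_eq0.
Qed.

Lemma zmod_morphismD (U V : zmodType) (f : U -> V) :
  zmod_morphism f -> {morph f : x y / x + y}.
Proof.
move=> fB x y; have f0 : f 0 = 0 by rewrite -(subrr 0) fB subrr.
by rewrite -[y in LHS]opprK fB -(sub0r y) fB f0 sub0r opprK.
Qed.

Section Coinduced.
Variables (R : pzRingType) (T : Type) (D : zmodType).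
Definition coind_pred (u : R -> T -> D) : bool := `[< zmod_morphism u >].
Fact coind_zmod_closed : zmod_closed coind_pred.
Proof.
split=> [|u v /asboolP hu /asboolP hv].
  by apply/asboolP => x y; rewrite [RHS]subrr.
apply/asboolP => x y; rewrite -![(u - v) _]/(u _ - v _) hu hv.
by rewrite !opprD opprK addrACA.
Qed.
HB.instance Definition _ :=
  GRing.isZmodClosed.Build (R -> T -> D) coind_pred coind_zmod_closed.
Record coind := Coind { coind_val : R -> T -> D; _ : coind_pred coind_val }.
HB.instance Definition _ := [isSub for coind_val].
HB.instance Definition _ := [Choice of coind by <:].
HB.instance Definition _ := [SubChoice_isSubZmodule of coind by <:].
Implicit Types (u v : coind) (a b : R).

Lemma coindB u a b : val u (a - b) = val u a - val u b.
Proof. by have /asboolP := valP u; apply. Qed.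

Lemma coindD u a b : val u (a + b) = val u a + val u b.
Proof. exact/zmod_morphismD/coindB. Qed.

Fact coind_scale_in a u : coind_pred (fun r => val u (r * a)).
Proof. by apply/asboolP => x y; rewrite mulrBl coindB. Qed.

Definition coind_scale a u := Coind (coind_scale_in a u).

Fact coind_scaleA a b v :
  coind_scale a (coind_scale b v) = coind_scale (a * b) v.
Proof. by apply: val_inj; apply/funext => r /=; rewrite mulrA. Qed.
Fact coind_scale1 : left_id 1 coind_scale.
Proof. by move=> u; apply: val_inj; apply/funext => r /=; rewrite mulr1. Qed.
Fact coind_scaleDr : right_distributive coind_scale +%R.
Proof. by move=> a u v; apply: val_inj. Qed.
Fact coind_scaleDl v : {morph coind_scale^~ v : a b / a + b}.
Proof.
move=> a b; apply: val_inj; apply/funext => r.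
rewrite -[RHS]/(val v (r * a) + val v (r * b)) /= mulrDr.
by rewrite coindD.
Qed.
HB.instance Definition _ := GRing.Zmodule_isLmodule.Build R coind
  coind_scaleA coind_scale1 coind_scaleDr coind_scaleDl.

End Coinduced.

Lemma coind_injective (R : pzRingType) (T : Type) (D : zmodType) :
  divisible_group D -> injective_module (coind R T D).
Proof.
move=> divD A B f g finj.
have hP (t : T) : {h : B -> D | zmod_morphism h /\ forall a : A, h (f a) = val (g a) 1 t}.
  apply: cid.
  have lf : linear (f : zmodule A -> zmodule B).
    by move=> k x y; rewrite raddfD /=; congr (_ + _); exact: raddfMz.
  have lg : linear (fun a : zmodule A => val (g a) 1 t : zmodule D).
    have gD x y : val (g (x + y)) 1 t = val (g x) 1 t + val (g y) 1 t.
      by rewrite linearD.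
    pose gt : A -> D := fun a => val (g a) 1 t.
    have gB : zmod_morphism gt by move=> x y; rewrite /gt linearB.
    pose ga : {additive A -> D} := HB.pack gt (GRing.isZmodMorphism.Build _ _ _ gB).
    by move=> k x y; rewrite gD; congr (_ + _); exact: (raddfMz ga).
  have [h hE] := divisible_injective divD (f := linear_of lf) (linear_of lg) finj.
  exists (h : B -> D); split=> [x y|a]; first exact: (linearB h).
  exact: hE.
pose k (b : B) (r : R) (t : T) : D := projT1 (hP t) (r *: b).
have kin b : coind_pred (k b).
  apply/asboolP => x y; apply/funext => t.
  by rewrite /k scalerBl (projT2 (hP t)).1.
have lk : linear (fun b => Coind (kin b)).
  move=> a x y; apply: val_inj; apply/funext => r; apply/funext => t /=.
  rewrite -[RHS]/(k x (r * a) t + k y r t) /k scalerDr scalerA.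
  exact: zmod_morphismD (projT2 (hP t)).1 _ _.
exists (linear_of lk) => a; apply: val_inj; apply/funext => r; apply/funext => t.
rewrite -[LHS]/(k (f a) r t) /k -linearZ (projT2 (hP t)).2 linearZ.
by rewrite -[LHS]/(val (g a) (1 * r) t) mul1r.
Qed.

Lemma enough_injectives (R : pzRingType) (M : lmodType R) :
  exists (J : lmodType R) (j : {linear M -> J}),
    injective j /\ injective_module J.
Proof.
pose T := {additive M -> QZ}.
pose k (m : M) (r : R) (chi : T) : QZ := chi (r *: m).
have kin m : coind_pred (k m).
  by apply/asboolP => x y; apply/funext => chi; rewrite /k scalerBl raddfB.
have lk : linear (fun m => Coind (kin m)).
  move=> a x y; apply: val_inj; apply/funext => r; apply/funext => chi /=.
  by rewrite -[RHS]/(k x (r * a) chi + k y r chi) /k scalerDr scalerA raddfD.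
exists (coind R T QZ), (linear_of lk); split; last exact/coind_injective/QZ_divisible.
move=> x y xy; apply/eqP; rewrite -subr_eq0; apply: contrapT => /negP xy0.
have [chi] := QZ_cogenerator xy0; apply/negP; rewrite negbK raddfB subr_eq0.
have : k x 1 chi = k y 1 chi by rewrite -[k x]/(val (linear_of lk x)) xy.
by rewrite /k !scale1r => ->.
Qed.

Theorem injective_envelope_exists (R : pzRingType) (M : lmodType R) :
  exists E : injEnvelope M, True.
Proof.
have [J [j [jinj Jinj]]] := enough_injectives M.
pose goodE (X : set J) := [/\ submod_Prop X, forall m, X (j m) &
  forall x, X x -> x != 0 -> exists (r : R) m, r *: x = j m /\ r *: x != 0].
have [||X [[Xsub jX Xess] Xmax]] := @Zorn_set _ goodE [set j m | m in setT].
- split=> [|m|_ [m _ <-] m0].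
  + split=> [|a _ _ [m _ <-] [n _ <-]]; first by exists 0; rewrite ?linear0.
    by exists (a *: m + n); rewrite ?linearP.
  + by exists m.
  + by exists 1, m; rewrite !scale1r.
- move=> F Fgood Ftot [X0 FX0]; split=> [|m|x [X FX Xx] x0].
  + split=> [|a u v [X FX Xu] [Y FY Yv]].
      by exists X0 => //; have [[+ _] _ _] := Fgood _ FX0.
    have [XY|YX] := Ftot _ _ FX FY.
      by exists Y => //; have [[_ +] _ _] := Fgood _ FY; apply=> //; exact: XY.
    by exists X => //; have [[_ +] _ _] := Fgood _ FX; apply=> //; exact: YX.
  + by exists X0 => //; have [] := Fgood _ FX0.
  + by have [_ _] := Fgood _ FX; apply.
pose goodC (C : set J) := submod_Prop C /\ forall x, C x -> X x -> x = 0.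
have [||C [[Csub CX] Cmax]] := @Zorn_set _ goodC [set 0].
- split=> [|x -> //]; split=> // a u v -> ->.
  by rewrite scaler0 addr0.
- move=> F Fgood Ftot [X0 FX0]; split=> [|x [Y FY Yx]]; last first.
    by have [_] := Fgood _ FY; apply.
  split=> [|a u v [Y FY Yu] [Z FZ Zv]].
    by exists X0 => //; have [[+ _] _] := Fgood _ FX0.
  have [YZ|ZY] := Ftot _ _ FY FZ.
    by exists Z => //; have [[_ +] _] := Fgood _ FZ; apply=> //; exact: YZ.
  by exists Y => //; have [[_ +] _] := Fgood _ FY; apply=> //; exact: ZY.
have [[X0 Xl] [C0 Cl]] := (Xsub, Csub).
pose P (z : J) := exists x c, [/\ X x, C c & z = x + c].
have hP : submod_Prop P.
  split; first by exists 0, 0; rewrite addr0.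
  move=> a _ _ [x [c [Xx Cc ->]]] [y [d [Xy Cd ->]]].
  exists (a *: x + y), (a *: c + d); split; [exact: Xl|exact: Cl|].
  by rewrite scalerDr addrACA.
have pP (z : submodType (submod_of hP)) : {x | X x /\ C (val z - x)}.
  apply: cid; have /submod_ofP[x [c [Xx Cc ->]]] := valP z.
  by exists x; rewrite addrC addKr.
have XB u v : X u -> X v -> X (u - v).
  by move=> Xu Xv; rewrite addrC -scaleN1r; exact: Xl.
have CB u v : C u -> C v -> C (u - v).
  by move=> Xu Xv; rewrite addrC -scaleN1r; exact: Cl.
have pE (z : submodType (submod_of hP)) x : X x -> C (val z - x) -> projT1 (pP z) = x.
  move=> Xx Cx; have [Xp Cp] := projT2 (pP z).
  apply/eqP; rewrite -subr_eq0; apply/eqP; apply: CX; last exact: XB.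
  by have := CB _ _ Cx Cp; rewrite opprB addrC addrA subrK.
have lp : linear (fun z => projT1 (pP z)).
  move=> a u v; have [[Xu Cu] [Xv Cv]] := (projT2 (pP u), projT2 (pP v)).
  apply: pE; first exact: Xl.
  have := Cl a _ _ Cu Cv; rewrite scalerBr addrACA -opprD; exact.
have lv : linear (fun z : submodType (submod_of hP) => val z) by [].
have [g gP] := Jinj _ _ (linear_of lv) (linear_of lp) val_inj.
have gX x : X x -> g x = x.
  move=> Xx; have xP : x \in submod_of hP.
    by apply/submod_ofP; exists x, 0; rewrite addr0.
  have -> : g x = projT1 (pP (Submod xP)) by exact: (gP (Submod xP)).
  by apply: pE => //=; rewrite subrr.
have gC c : C c -> g c = 0.
  move=> Cc; have cP : c \in submod_of hP.
    by apply/submod_ofP; exists 0, c; rewrite add0r.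
  have -> : g c = projT1 (pP (Submod cP)) by exact: (gP (Submod cP)).
  by apply: pE => //=; rewrite subr0.
have gim y : X (g y).
  rewrite -[X](Xmax [set g z | z in setT]); first by exists y.
    by move=> x Xx; exists x => //; exact: gX.
  split=> [|m|_ [z _ <-] gz0].
  - split; first by exists 0; rewrite ?linear0.
    by move=> a _ _ [u _ <-] [v _ <-]; exists (a *: u + v); rewrite ?linearP.
  - by exists (j m) => //; apply: gX.
  - pose C' := [set w | exists c (r : R), C c /\ w = c + r *: z].
    have CC' : C `<=` C' by move=> c Cc; exists c, 0; rewrite scale0r addr0.
    have nC' : ~ goodC C'.
      move=> gC'; have C'E := Cmax _ CC' gC'.
      case/eqP: gz0; apply: gC; rewrite -C'E.
      by exists 0, 1; rewrite scale1r add0r.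
    have [w [C'w Xw w0]] : exists w, [/\ C' w, X w & w != 0].
      apply: contrapT => no; apply: nC'; split.
        split; first exact: CC'.
        move=> a _ _ [c [r [Cc ->]]] [d [s [Cd ->]]].
        exists (a *: c + d), (a * r + s); split; first exact: Cl.
        by rewrite scalerDl -scalerA scalerDr addrACA.
      move=> x C'x Xx; apply: contrapT => /eqP x0; apply: no.
      by exists x.
    have [r [m [rw rw0]]] := Xess w Xw w0.
    case: C'w => c [s [Cc wE]].
    have gw : w = s *: g z by rewrite -(gX w Xw) wE linearD gC // add0r linearZ.
    by exists (r * s), m; rewrite -scalerA -gw.
pose S := submod_of Xsub.
have gS y : g y \in S by apply/submod_ofP.
have jS m : j m \in S by apply/submod_ofP.
have lj : linear (fun m => Submod (jS m)).
  by move=> a u v; apply: val_inj; rewrite /= linearP.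
have lr : linear (fun y => Submod (gS y)).
  by move=> a u v; apply: val_inj; rewrite /= linearP.
have lS : linear (fun z : submodType S => val z) by [].
suff [ess inj] : essential_mono (linear_of lj) /\ injective_module (submodType S).
  by exists (InjEnvelope ess inj).
split.
  split=> [x y /(congr1 val) /jinj //|N [x Nx x0]].
  have Xx : X (val x) by apply/(submod_ofP Xsub)/(valP x).
  have vx0 : val x != 0 by rewrite -[0]/(val (0 : submodType S)) (inj_eq val_inj).
  have [r [m [rm rx0]]] := Xess _ Xx vx0.
  have jE : linear_of lj m = r *: x by apply: val_inj; rewrite /= -rm.
  exists m; rewrite jE; split; first exact: rpredZ.
  by rewrite -(inj_eq val_inj).
move=> A B f h finj.
have [k kP] := Jinj _ _ f (linear_of lS \o h : {linear A -> J}) finj.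
exists (linear_of lr \o k : {linear B -> submodType S}) => a.
apply: val_inj; rewrite -[LHS]/(g (k (f a))) kP.
by apply: gX; exact/(submod_ofP Xsub)/(valP (h a)).
Qed.

Definition injective_envelope (R : pzRingType) (M : lmodType R) : injEnvelope M :=
  projT1 (cid (injective_envelope_exists M)).

Lemma injEnvelope_unique (R : pzRingType) (M : lmodType R) (E E' : injEnvelope M) :
  exists f : {linear E -> E'},
    bijective f /\ forall m, f (env_map E m) = env_map E' m.
Proof.
have inj (F F' : injEnvelope M) (k : {linear F -> F'}) :
    (forall m, k (env_map F m) = env_map F' m) -> injective k.
  move=> kE; have hP : submod_Prop (fun x => k x = 0).
    split; first exact: linear0.
    by move=> a u v ku kv; rewrite linearP ku kv scaler0 addr0.
  move=> x y kxy; apply/eqP; rewrite -subr_eq0; apply: contrapT => /negP xy0.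
  have [|m [/submod_ofP]] := (env_essential F).2 (submod_of hP).
    by exists (x - y) => //; apply/submod_ofP; rewrite linearB kxy subrr.
  rewrite kE -(linear0 (env_map F')) => /(env_essential F').1 ->.
  by rewrite linear0 eqxx.
have [f fE] := env_injective (env_map E') (env_essential E).1.
have finj := inj _ _ _ fE.
have [g gE] := @env_injective _ _ E _ _ f idfun finj.
have ginj : injective g by apply: (inj E' E) => m; rewrite -fE gE.
exists f; split=> //; exists g => [x|y]; first exact: gE.
by apply: ginj; rewrite gE.
Qed.

(* For left hereditary rings this is the left-right symmetric QF-3+. *)
Definition left_QF3plus (R : pzRingType) : Prop :=
  projective_module (injective_envelope R^o).

(* [Qmax R] is a left R-module by multiplication along the inclusion
   [Qmax_inj] of R; see [Qmax_scaleE]. *)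
Definition Qmax (R : pzRingType) : Type := Qmax_of (injective_envelope R^o).
HB.instance Definition _ (R : pzRingType) := GRing.PzRing.on (Qmax R).
HB.instance Definition _ (R : pzRingType) := GRing.Lmodule.on (Qmax R).

(* Main.v *)
(* A left hereditary ring R is left nonsingular, so Q = Qmax R is all of
   E = I(R); this already gives the implication from right to left.

   Conversely let E be projective.  Finitely many functionals E -> R separate
   the points of E, so every left ideal of Q is projective over R, and its
   coordinate functionals, extended to E, are right multiplications by elements
   of Q.  Also Q is left self-injective.  Hence it suffices to show, as in
   Osofsky's theorem for hereditary rings, that every left ideal of Q is
   generated by an idempotent.  If not, some union S of a strictly increasing
   sequence of principal left ideals is not, and we take T maximal among the
   left ideals without this property between S and the double annihilator of
   S.  As T is projective and S is countably generated, T is countably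
   generated, hence T = T1 + T2 is a direct sum of two non-principal left
   ideals.  Replacing T1 by its injective envelope in Q enlarges T to a left
   ideal that is still not principal, a contradiction. *)

Require Import Defs.
From mathcomp Require Import all_boot all_order all_algebra.
From mathcomp Require Import all_classical.

Set Implicit Arguments.
Unset Strict Implicit.
Unset Printing Implicit Defensive.

Import GRing.Theory.
Local Open Scope ring_scope.
Local Open Scope classical_set_scope.

(** * Finite sums and left ideals *)

Lemma big_support (I : eqType) (V : nmodType) (F : I -> V) (s u : seq I) :
  uniq s -> uniq u ->
  (forall i, F i != 0 -> i \in s) -> (forall i, F i != 0 -> i \in u) ->
  \sum_(i <- s) F i = \sum_(i <- u) F i.
Proof.
move=> us uu Fs Fu.
have E r : \sum_(i <- r) F i = \sum_(i <- [seq i <- r | F i != 0]) F i.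
  rewrite big_filter [LHS](bigID (fun i => F i != 0)) /= [X in _ + X]big1 ?addr0 //.
  by move=> i /negPn/eqP.
rewrite E (E u); apply/perm_big/uniq_perm; rewrite ?filter_uniq // => i.
by rewrite !mem_filter; case: (boolP (F i != 0)) => //= Fi; rewrite Fs ?Fu.
Qed.

Section LeftIdeals.
Variable A : pzRingType.
Implicit Types (S T K : set A) (a e p q x y z : A).

Definition left_ideal T := T 0 /\ forall a x y, T x -> T y -> T (a * x + y).

(** For a left ideal [T], such an [e] is an idempotent with [T = A e], so [T] is a direct summand of
    [A]. *)
Definition right_identity T e := T e /\ forall x, T x -> x * e = x.

(** Baer's form of injectivity of [A] as a left module over itself. *)
Definition self_injective := forall T (f : A -> A), left_ideal T ->
  (forall a x y, T x -> T y -> f (a * x + y) = a * f x + f y) ->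
  exists p, forall x, T x -> f x = x * p.

(* The coordinates on the dual basis [t |-> (t, x |-> x * q t)] of [T] are
   right multiplications by elements of the ring. *)
Definition dual_basis T := exists q : A -> A,
  (forall t, ~ T t -> q t = 0) /\
  forall x, T x -> exists s : seq A, [/\ uniq s, forall t, x * q t != 0 -> t \in s
    & x = \sum_(t <- s) x * q t * t].

Lemma left_idealM T a x : left_ideal T -> T x -> T (a * x).
Proof. by case=> T0 Tl Tx; rewrite -[_ * _]addr0; exact: Tl. Qed.

Lemma left_idealD T x y : left_ideal T -> T x -> T y -> T (x + y).
Proof. by case=> _ Tl Tx Ty; rewrite -[x]mul1r; exact: Tl. Qed.

Lemma left_idealB T x y : left_ideal T -> T x -> T y -> T (x - y).
Proof. by case=> _ Tl Tx Ty; rewrite addrC -mulN1r; exact: Tl. Qed.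

Lemma left_ideal_sum T (I : Type) (s : seq I) (F : I -> A) :
  left_ideal T -> (forall i, T (F i)) -> T (\sum_(i <- s) F i).
Proof. by move=> lT TF; apply: big_ind => [|x y|//]; [case: lT|exact: left_idealD]. Qed.

Lemma left_ideal_bigcup (F : set (set A)) :
  (forall X, F X -> left_ideal X) -> total_on F subset -> F !=set0 ->
  left_ideal (\bigcup_(X in F) X).
Proof.
move=> lF tF [X0 FX0]; split; first by exists X0 => //; have [] := lF _ FX0.
move=> a x y [X FX Xx] [Y FY Yy].
have [XY|YX] := tF _ _ FX FY.
  by exists Y => //; apply: (lF _ FY).2 => //; exact: XY.
by exists X => //; apply: (lF _ FX).2 => //; exact: YX.
Qed.

Definition left_add S T := [set z | exists x y, [/\ S x, T y & z = x + y]].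

Lemma left_ideal_add S T : left_ideal S -> left_ideal T -> left_ideal (left_add S T).
Proof.
move=> [S0 Sl] [T0 Tl]; split; first by exists 0, 0; rewrite addr0.
move=> a _ _ [x [y [Sx Ty ->]]] [x' [y' [Sx' Ty' ->]]].
exists (a * x + x'), (a * y + y'); split; [exact: Sl|exact: Tl|].
by rewrite mulrDr addrACA.
Qed.

Definition principal x := [set a * x | a in setT].

Lemma left_ideal_principal x : left_ideal (principal x).
Proof.
split; first by exists 0; rewrite ?mul0r.
by move=> a _ _ [b _ <-] [c _ <-]; exists (a * b + c); rewrite // mulrDl mulrA.
Qed.

Lemma principal_id x : principal x x.
Proof. by exists 1; rewrite ?mul1r. Qed.

(** * Von Neumann regularity and injective hulls of left ideals *)

Section Semisimplicity.
Hypothesis Ainj : self_injective.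
Hypothesis Adual : forall T, left_ideal T -> dual_basis T.

(** The dual basis, summed over the support of the single generator [x], gives [e] with [x * e = x];
    all multiples of [x] follow. So [A] is von Neumann regular. *)
Lemma principal_right_identity x : exists e, right_identity (principal x) e.
Proof.
have [q [qT /(_ x (principal_id x))[s [us _ xE]]]] := Adual (left_ideal_principal x).
exists (\sum_(t <- s) q t * t); split.
  apply: left_ideal_sum; first exact: left_ideal_principal.
  move=> t; have [Tt|/qT->] := pselect (principal x t); last first.
    by rewrite mul0r; case: (left_ideal_principal x).
  by apply: left_idealM => //; exact: left_ideal_principal.
move=> _ [a _ <-]; rewrite -mulrA; congr (_ * _).
by rewrite mulr_sumr [RHS]xE; apply: eq_bigr => t _; rewrite mulrA.
Qed.

(** For [z = x - x * g], an idempotent generator [h] of [A z] satisfies [h * g = 0], and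
    [g + h - g * h] is an idempotent generating [A g + A x]. *)
Lemma idempotent_extend T g x : left_ideal T -> T g -> g * g = g -> T x ->
  exists g', [/\ T g', g' * g' = g', g * g' = g, g' * g = g & x * g' = x].
Proof.
move=> lT Tg gg Tx; pose z := x - x * g.
have Tz : T z by apply: left_idealB => //; exact: left_idealM.
have [h [[a _ ah] hz]] := principal_right_identity z.
have zh : z * h = z by exact/hz/principal_id.
have hh : h * h = h by apply: hz; exists a.
have Th : T h by rewrite -ah; exact: left_idealM.
have zg : z * g = 0 by rewrite mulrBl -mulrA gg subrr.
have hg : h * g = 0 by rewrite -ah -mulrA zg mulr0.
have hg' : h * (g + (h - g * h)) = h by rewrite mulrDr hg add0r mulrBr mulrA hg mul0r subr0.
have gg' : g * (g + (h - g * h)) = g by rewrite mulrDr gg mulrBr mulrA gg subrr addr0.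
have xh : x * (h - g * h) = z by rewrite mulrBr mulrA -mulrBl.
exists (g + (h - g * h)); split => //.
- by apply: left_idealD => //; apply: left_idealB => //; exact: left_idealM.
- by rewrite mulrDl gg' mulrBl -mulrA hg'.
- by rewrite mulrDl mulrBl -mulrA hg mulr0 subr0 addr0.
- by rewrite mulrDr xh /z addrC subrK.
Qed.

Definition essential_ideal T :=
  forall y, y != 0 -> exists a, T (a * y) /\ a * y != 0.

(** By regularity [x = x * b * x]. If [x * b] were nonzero, [T] would contain a nonzero [a * x * b],
    yet this equals [(a * x * b) * x * b = 0]. *)
Lemma essential_annihilator T x : essential_ideal T ->
  (forall y, T y -> y * x = 0) -> x = 0.
Proof.
move=> eT Tx; have [_ [[b _ <-] xb]] := principal_right_identity x.
have xx : x * (b * x) = x by exact/xb/principal_id.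
have : x * b = 0; last by move=> xb0; rewrite -xx mulrA xb0 mul0r.
apply: contrapT => /eqP /eT [a [Ta /eqP]]; apply.
by rewrite -[in LHS]xx [x * (b * x)]mulrA -(mulrA (x * b)) mulrA mulrA Tx // mul0r.
Qed.

(* [q] generates the injective envelope of [S] inside the ring. *)
Lemma hull S : left_ideal S ->
  exists q, (forall s, S s -> s * q = s) /\
    forall y, (forall s, S s -> s * y = 0) -> q * y = 0.
Proof.
(* [K] will be a complement of [S], so that [S + K] is essential; [q] then represents the projection
   onto [S] along [K]. *)
move=> lS; pose good K := left_ideal K /\ forall x, S x -> K x -> x = 0.
have [||K [[lK SK] Kmax]] := @Zorn_set _ good [set 0].
- split=> [|x _ -> //]; split=> // a _ _ -> ->.
  by rewrite mulr0 addr0.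
- move=> F Fgood tF nF; split=> [|x Sx [K FK Kx]].
    by apply: left_ideal_bigcup => // X /Fgood [].
  by have [_] := Fgood _ FK; apply.
pose L := left_add S K.
have lL : left_ideal L by exact: left_ideal_add.
have SL : S `<=` L by move=> s Ss; exists s, 0; rewrite addr0; split=> //; case: lK.
have KL : K `<=` L by move=> k Kk; exists 0, k; rewrite add0r; split=> //; case: lS.
have [f fP] : exists f : A -> A, forall s k, S s -> K k -> f (s + k) = s.
  have ex z : exists w, forall s k, S s -> K k -> z = s + k -> w = s.
    have [[s [k [Ss Kk ->]]]|no] := pselect (L z); last first.
      by exists 0 => s k Ss Kk zE; case: no; exists s, k.
    exists s => s' k' Ss' Kk' E; apply/eqP; rewrite -subr_eq0; apply/eqP.
    apply: SK; first exact: left_idealB.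
    have -> : s - s' = k' - k by apply/eqP; rewrite subr_eq addrAC eq_sym subr_eq E addrC.
    exact: left_idealB.
  by exists (fun z => projT1 (cid (ex z))) => s k Ss Kk; apply: (projT2 (cid (ex (s + k)))) Ss Kk _.
have [|q qP] := Ainj (f := f) lL.
  move=> a _ _ [s [k [Ss Kk ->]]] [s' [k' [Ss' Kk' ->]]].
  rewrite mulrDr addrACA !fP //; [exact: lS.2|exact: lK.2].
have Sq s : S s -> s * q = s.
  by move=> Ss; rewrite -qP; [rewrite -[s in LHS]addr0 fP //; case: lK|exact: SL].
have Kq k : K k -> k * q = 0.
  by move=> Kk; rewrite -qP; [rewrite -[k]add0r fP //; case: lS|exact: KL].
exists q; split=> // y Sy; apply: (@essential_annihilator L) => [x x0|z [s [k [Ss Kk ->]]]]; last first.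
  by rewrite mulrA mulrDl Sq // Kq // addr0 Sy.
have [Kx|nKx] := pselect (K x).
  by exists 1; rewrite mul1r; split=> //; exact: KL.
apply: contrapT => no.
have lKx := left_ideal_add lK (left_ideal_principal x).
have KKx : K `<=` left_add K (principal x).
  by move=> k Kk; exists k, 0; rewrite addr0; split=> //; case: (left_ideal_principal x).
apply: nKx; rewrite -(Kmax _ KKx).
  by exists 0, x; rewrite add0r; split; [case: lK|exact: principal_id|].
split=> // s Ss [k [_ [Kk [a _ <-] sE]]].
have [ax0|ax0] := eqVneq (a * x) 0; first by apply: SK => //; rewrite sE ax0 addr0.
case: no; exists a; split=> //; exists s, (- k); split=> //.
  by rewrite -mulN1r; exact: left_idealM.
by rewrite sE addrAC subrr add0r.
Qed.


(** * Ascending chains of idempotents *)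

Lemma nondirect_right T e : T e -> ~ right_identity T e -> exists2 x, T x & x * e <> x.
Proof.
move=> Te nTe; apply: contrapT => no; apply: nTe; split=> // x Tx.
by apply: contrapT => xe; apply: no; exists x.
Qed.

(* A strictly increasing chain of idempotents in [T]: the principal ideals
   [A * g n] strictly increase, and their union is not principal. *)
Definition ladder (g : nat -> A) := forall n,
  [/\ g n * g n = g n, g n * g n.+1 = g n, g n.+1 * g n = g n & g n.+1 <> g n].

Definition ladder_span (g : nat -> A) := [set x | exists n, x * g n = x].

Definition nondirect T := left_ideal T /\ forall e, ~ right_identity T e.

(** Each rung absorbs [d n] and then an element of [T] that the previous idempotent does not fix,
    which keeps the chain strict. *)
Lemma ladder_exists T (d : nat -> A) : nondirect T -> (forall n, T (d n)) ->
  exists g, [/\ ladder g, forall n, T (g n) & forall n, d n * g n.+1 = d n].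
Proof.
move=> [lT nT] Td; pose I := {g | T g /\ g * g = g}.
have step n (i : I) : exists j : I, let g := sval i in let g' := sval j in
    [/\ g * g' = g, g' * g = g, g' <> g & d n * g' = d n].
  case: i => g [Tg gg] /=.
  have [x Tx xg] := nondirect_right Tg (nT g).
  have [g1 [Tg1 g1g1 gg1 g1g dg1]] := idempotent_extend lT Tg gg (Td n).
  have [g2 [Tg2 g2g2 g1g2 g2g1 xg2]] := idempotent_extend lT Tg1 g1g1 Tx.
  exists (exist _ g2 (conj Tg2 g2g2)) => /=; split.
  - by rewrite -gg1 -mulrA g1g2.
  - by rewrite -g1g mulrA g2g1.
  - by move=> g2g; apply: xg; rewrite -g2g.
  - by rewrite -dg1 -mulrA g1g2.
have T0 : T 0 /\ 0 * 0 = 0 :> A by rewrite mulr0; case: lT.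
pose G := fix G n : I := if n is m.+1 then projT1 (cid (step m (G m))) else exist _ 0 T0.
have GS n := projT2 (cid (step n (G n))).
exists (fun n => sval (G n)); split=> n; first by have /= [] := GS n; case: (svalP (G n)).
  by case: (svalP (G n)).
by have [] := GS n.
Qed.

Lemma ladder_le g n m : ladder g -> (n <= m)%N ->
  g n * g m = g n /\ g m * g n = g n.
Proof.
move=> gP /subnK <-; elim: (m - n)%N => [|k [IH1 IH2]].
  by have [] := gP n.
have [_ g1 g2 _] := gP (k + n)%N.
by rewrite addSn -[in LHS]IH1 -mulrA g1 IH1 -[in X in _ /\ X]IH2 mulrA g2.
Qed.

Lemma ladder_span_le g n m x : ladder g -> (n <= m)%N -> x * g n = x -> x * g m = x.
Proof. by move=> gP nm <-; rewrite -mulrA (ladder_le gP nm).1. Qed.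

Lemma ladder_span_mem g n : ladder g -> ladder_span g (g n).
Proof. by move=> gP; exists n; have [] := gP n. Qed.

Lemma left_ideal_ladder g : ladder g -> left_ideal (ladder_span g).
Proof.
move=> gP; split; first by exists 0%N; rewrite mul0r.
move=> a x y [n xn] [m ym]; exists (maxn n m); rewrite mulrDl -mulrA.
by rewrite (ladder_span_le gP (leq_maxl n m) xn) (ladder_span_le gP (leq_maxr n m) ym).
Qed.

(** A right identity would already lie in some [A * g n], which forces [g n.+1 = g n]. *)
Lemma ladder_nondirect g : ladder g -> nondirect (ladder_span g).
Proof.
move=> gP; split=> [|e [[n en] eP]]; first exact: left_ideal_ladder.
have [_ _ gg /=] := gP n; apply; rewrite -gg.
by rewrite -(eP (g n.+1) (ladder_span_mem _ gP)) -mulrA en.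
Qed.

Lemma ladder_sub g T : left_ideal T -> (forall n, T (g n)) -> ladder_span g `<=` T.
Proof. by move=> lT Tg x [n <-]; exact: left_idealM. Qed.

(* The even steps [g j.+1 - g j] of the ladder and its odd steps span
   complementary summands of [ladder_span g]; neither is direct. *)
Lemma ladder_split g : ladder g -> exists p,
  [/\ forall x, ladder_span g x -> ladder_span g (x * p) /\ x * p * p = x * p,
      nondirect [set x | ladder_span g x /\ x * p = x] &
      nondirect [set x | ladder_span g x /\ x * p = 0]].
Proof.
move=> gP; set T := ladder_span g; pose h j := g j.+1 - g j.
pose v n := \sum_(0 <= j < n) h j *+ ~~ odd j.
have lT : left_ideal T := left_ideal_ladder gP.
have xh n j x : x * g n = x -> (n <= j)%N -> x * h j = 0.
  by move=> xn nj; rewrite mulrBr !(ladder_span_le gP _ xn) ?subrr // leqW.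
have hg n j : (j < n)%N -> h j * g n = h j.
  by move=> jn; rewrite mulrBl (ladder_le gP jn).1 (ladder_le gP (ltnW jn)).1.
have hg0 n j : (n <= j)%N -> h j * g n = 0.
  by move=> nj; rewrite mulrBl (ladder_le gP nj).2 (ladder_le gP (leqW nj)).2 subrr.
have Th j : T (h j) by exists j.+1; exact: hg.
have hh j : h j * h j = h j.
  by rewrite {2}/h mulrBr hg // hg0 // subr0.
have hn0 j : h j <> 0 by move=> /eqP; rewrite subr_eq0 => /eqP; have [] := gP j.
have xv n m x : x * g n = x -> (n <= m)%N -> x * v m = x * v n.
  move=> xn /subnK <-; elim: (m - n)%N => // k IH.
  rewrite addSn /v big_nat_recr //= mulrDr IH mulrnAr (xh n) ?leq_addl //.
  by rewrite mul0rn addr0.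
(* An [x] in [A * g n] is killed by all later steps, so [x * v n] stabilises. The infinite sum of
   even steps thus acts on the span, and self-injectivity makes it right multiplication by some
   [p]. *)
have [f fP] : exists f : A -> A, forall n x, x * g n = x -> f x = x * v n.
  have ex x : exists y, forall n, x * g n = x -> y = x * v n.
    have [[n xn]|no] := pselect (T x); last by exists 0 => n xn; case: no; exists n.
    exists (x * v n) => m xm; have [nm|/ltnW mn] := leqP n m; first by rewrite (xv n m).
    exact: xv.
  by exists (fun x => projT1 (cid (ex x))) => n x; apply: (projT2 (cid (ex x))).
have [|p pP] := Ainj (f := f) lT.
  move=> a x y [n xn] [m ym].
  have xM := ladder_span_le gP (leq_maxl n m) xn.
  have yM := ladder_span_le gP (leq_maxr n m) ym.
  rewrite (fP _ _ xM) (fP _ _ yM) (fP (maxn n m)) mulrDl -mulrA ?xM ?yM // mulrA //.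
have hp j : h j * p = h j *+ ~~ odd j.
  rewrite -pP // (fP j.+1) ?hg // /v big_nat_recr //= mulrDr mulrnAr hh.
  rewrite mulr_sumr big_nat_cond big1 ?add0r // => i /andP[/andP[_ ij] _].
  by rewrite mulrnAr {2}/h mulrBr !hg0 ?subrr ?mul0rn // ltnW.
have xp n x : x * g n = x -> x * p = x * v n by move=> xn; rewrite -pP ?(fP n) //; exists n.
have direct_p (b : bool) : nondirect [set x | T x /\ x * p = x *+ b].
  split=> [|e [[[n en] ep] eP]].
    split=> [|a x y [Tx xpx] [Ty yp]]; first by split; [case: lT|rewrite mul0r mul0rn].
    split; first exact: lT.2.
    by rewrite mulrDl -mulrA xpx yp mulrnAr -mulrnDl.
  (* A step [h j] in this summand with [n <= j] is killed by [g n], although [e = e * g n] should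
     fix it. *)
  have [j [nj jb]] : exists j, (n <= j)%N /\ ~~ odd j = b.
    exists ((~~ b) + n.*2)%N; split; last by rewrite oddD odd_double addbF; case: (b).
    by apply: leq_trans (leq_addl _ _); rewrite -addnn leq_addr.
  apply: (hn0 j); rewrite -(eP (h j)); last by split=> //; rewrite hp jb.
  by rewrite -en mulrA (eP (h j)) ?hg0 //; split=> //; rewrite hp jb.
exists p; split; [|exact: (direct_p true)|exact: (direct_p false)].
move=> x [n xn]; rewrite (xp n) //; split.
  apply: left_idealM => //; rewrite /v; apply: left_ideal_sum => // j.
  by case: (~~ odd j); [exact: Th|case: lT].
rewrite -mulrA /v mulr_suml; congr (_ * _); apply: eq_bigr => j _.
by rewrite mulrnAl hp; case: (~~ _).
Qed.

(* Only countably many coordinates are nonzero on [S], and these determine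
   all of [T] because [T] is contained in the double annihilator of [S]. *)
Lemma countable_right_identity g T : ladder g -> left_ideal T ->
  (forall n, T (g n)) ->
  (forall y, (forall n, g n * y = 0) -> forall x, T x -> x * y = 0) ->
  exists d : nat -> A, (forall n, T (d n)) /\ forall x, T x -> exists n, x * d n = x.
Proof.
move=> gP lT Tg gT; have [q [qT qP]] := Adual lT.
pose s n := projT1 (cid (qP _ (Tg n))).
have sP n t : g n * q t != 0 -> t \in s n.
  by rewrite /s; case: cid => /= r [_ + _]; apply.
pose u := fix u n : seq A := if n is m.+1 then undup (s m ++ u m) else [::].
have us n : uniq (u n) by case: n => //= n; exact: undup_uniq.
have uS t n m : (n <= m)%N -> t \in u n -> t \in u m.
  move=> /subnK <- tn; elim: (m - n)%N => // k IH.
  by rewrite addSn /= mem_undup mem_cat IH orbT.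
(* [u n] contains every coordinate that is nonzero on some [g m] with [m < n]; the dual basis
   truncated to [u n] fixes each [x] whose support lies in [u n]. *)
exists (fun n => \sum_(t <- u n) q t * t); split.
  move=> n; apply: left_ideal_sum => // t.
  have [Tt|/qT->] := pselect (T t); first exact: left_idealM.
  by rewrite mul0r; case: lT.
move=> x Tx; have [r [ur rP xE]] := qP x Tx.
have tu t : x * q t != 0 -> exists n, t \in u n.
  move=> xt; apply: contrapT => no; case/eqP: xt; apply: gT => // n.
  apply: contrapT => /eqP /sP ts; apply: no; exists n.+1.
  by rewrite /= mem_undup mem_cat ts.
have [n nP] : exists n, forall t, t \in r -> x * q t != 0 -> t \in u n.
  elim: (r) => [|t r' [n IH]]; first by exists 0%N.
  have [xt|xt] := eqVneq (x * q t) 0.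
    by exists n => t'; rewrite in_cons => /orP[/eqP->|/IH //]; rewrite xt eqxx.
  have [m tm] := tu _ xt; exists (maxn n m) => t'.
  rewrite in_cons => /orP[/eqP->|/IH t'r] xt'; first exact: uS (leq_maxr _ _) tm.
  exact: uS (leq_maxl _ _) (t'r xt').
exists n; rewrite mulr_sumr [RHS]xE.
under eq_bigr do rewrite mulrA.
have nz t : x * q t * t != 0 -> x * q t != 0 by apply: contra => /eqP->; rewrite mul0r.
by apply: big_support => // t /nz xt; [exact/nP/xt/rP|exact: rP].
Qed.

Lemma direct_left_ideal T : left_ideal T -> exists e, right_identity T e.
Proof.
move=> lT0; apply: contrapT => nT0.
have [g [gP T0g _]] : exists g, [/\ ladder g, forall n, T (g n) & forall n : nat, 0 * g n.+1 = 0].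
  apply: (ladder_exists (d := fun=> 0)); last by case: lT0.
  by split=> // e eP; apply: nT0; exists e.
(* The last clause puts [X] inside the left annihilator of the right annihilator of the ladder; this
   will make [X] countably generated. *)
pose good X := [/\ nondirect X, forall n, X (g n) &
  forall y, (forall n, g n * y = 0) -> forall x, X x -> x * y = 0].
have [||X [[Xnd Xg gX] Xmax]] := @Zorn_set _ good (ladder_span g).
- split=> [|n|y gy x [n <-]]; first exact: ladder_nondirect.
    exact: ladder_span_mem.
  by rewrite -mulrA gy mulr0.
- move=> F Fgood tF [X0 FX0].
  have lU : left_ideal (\bigcup_(X in F) X).
    by apply: left_ideal_bigcup => [X /Fgood [[]]| |] //; exists X0.
  split=> [|n|y gy x [X FX Xx]].
  + split=> // e [[X FX Xe] eP]; have [[lX nX] _ _] := Fgood _ FX.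
    by apply: (nX e); split=> // x Xx; apply: eP; exists X.
  + by exists X0 => //; have [] := Fgood _ FX0.
  + by have [_ _] := Fgood _ FX; apply.
have lX : left_ideal X := Xnd.1.
have [d [Xd dP]] := countable_right_identity gP lX Xg gX.
have [g' [g'P Xg' dg']] := ladder_exists Xnd Xd.
have XE : X = ladder_span g'.
  apply/seteqP; split; last exact: ladder_sub.
  by move=> x /dP[n xn]; exists n.+1; rewrite -xn -mulrA dg'.
have [p [Xp [lX1 nX1] [lX2 nX2]]] := ladder_split g'P.
rewrite -XE in Xp lX1 nX1 lX2 nX2.
have [q [X1q qP]] := hull lX1.
(* The first summand annihilates [1 - p], hence so does its hull [q]. *)
have qp : q * p = q.
  apply/eqP; rewrite -subr_eq0 -[X in _ - X]mulr1 -mulrBr; apply/eqP.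
  by apply: qP => x [_ xp]; rewrite mulrBr xp mulr1 subrr.
have lq := left_ideal_principal q.
have XXq : X `<=` left_add X (principal q).
  by move=> x Xx; exists x, 0; rewrite addr0; split=> //; case: lq.
have XqE : left_add X (principal q) = X.
  apply: Xmax => //; split=> [|n|y gy _ [x [_ [Xx [a _ <-] ->]]]].
  + split=> [|e [[t [_ [Xt [a _ <-] eE]]] eP]]; first exact: left_ideal_add.
    (* Right multiplication by [1 - p] kills [A q], so a right identity [e] of the enlarged ideal
       would yield the right identity [e - e * p] of the second summand. *)
    have e1p : e - e * p = t - t * p.
      by rewrite eE mulrDl -mulrA qp opprD addrACA subrr addr0.
    apply: (nX2 (e - e * p)); split.
      rewrite e1p; have [Xtp tpp] := Xp t Xt; split; first exact: left_idealB.
      by rewrite mulrBl tpp subrr.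
    move=> x [Xx xp]; have xe := eP _ (XXq _ Xx).
    by rewrite mulrBr mulrA xe xp subr0.
  + exact: XXq.
  + have xy := gX _ gy; rewrite mulrDl xy // -mulrA qP ?mulr0 ?add0r //.
    by move=> z [Xz _]; exact: xy.
(* By maximality [q] lies in [X], and [q * p = q] places it in the first summand, where it is a
   right identity. *)
apply: (nX1 q); split; last exact: X1q.
split=> //; rewrite -XqE; exists 0, q; rewrite add0r; split=> //; first by case: lX.
exact: principal_id.
Qed.

End Semisimplicity.
End LeftIdeals.

(** * From idempotent generators to semisimplicity *)

(** A map on a left ideal with right identity [e] is determined by the image of [e], so Baer's
    criterion makes every module injective. The identity of [S] extends to a retraction, whose
    kernel is a complement. *)
Lemma semisimple_right_identity (A : pzRingType) :
  (forall T : set A, left_ideal T -> exists e, right_identity T e) ->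
  semisimple_ring A.
Proof.
move=> Adir M S.
have Minj (N : lmodType A) : injective_module N.
  apply: baer => I f; have [|e [eI eP]] := Adir [set x | (x : A^o) \in I].
    by split=> [|a x y xI yI]; [exact: rpred0|exact/rpredD/yI/(rpredZ a xI)].
  exists (f (Submod eI)) => r; rewrite -linearZ /=; congr (f _).
  by apply: val_inj; rewrite /= [RHS](eP (val r)) //; exact: valP.
have [h hP] := Minj _ _ _ (val : {linear submodType S -> M}) idfun val_inj.
have lK : submod_Prop (fun x => h x = 0).
  by split=> [|a u v hu hv]; rewrite ?linear0 // linearP hu hv scaler0 addr0.
exists (submod_of lK); split=> [x xS /submod_ofP hx|x].
  by have := hP (Submod xS); rewrite /= hx => /(congr1 val) /= <-.
exists (val (h x)), (x - val (h x)); split; first exact: valP.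
  by apply/submod_ofP; rewrite linearB hP subrr.
by rewrite addrC subrK.
Qed.

(** * Dual bases and projectivity over hereditary rings *)

Section Modules.
Variable R : pzRingType.
Implicit Types M N U V : lmodType R.

Lemma corestrict U V (S : submodClosed V) (f : {linear U -> V}) :
  (forall x, f x \in S) ->
  exists f' : {linear U -> submodType S}, forall x, val (f' x) = f x.
Proof.
move=> fS; have lf : linear (fun x => Submod (fS x)).
  by move=> a x y; apply: val_inj; rewrite /= linearP.
by exists (linear_of lf).
Qed.

Lemma projective_retract M N (f : {linear M -> N}) (g : {linear N -> M}) :
  cancel f g -> projective_module N -> projective_module M.
Proof.
move=> fK Nproj A B p h p_surj.
have [k kP] := Nproj A B p (h \o g : {linear N -> B}) p_surj.
by exists (k \o f : {linear M -> A}) => x; rewrite /= kP /= fK.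
Qed.

(** The free module on the elements of [M], built as the finitely supported functions, maps onto
    [M]; the functionals are the coordinates of a section. *)
Lemma projective_dual_basis M : projective_module M ->
  exists phi : M -> {linear M -> R^o}, forall x, exists s : seq M,
    [/\ uniq s, forall t, phi t x != 0 -> t \in s & x = \sum_(t <- s) (phi t x : R) *: t].
Proof.
move=> Mproj.
pose P (f : M -> R^o) := exists s : seq M, forall t, f t != 0 -> t \in s.
have hP : submod_Prop P.
  split=> [|a f h [s sP] [r rP]]; first by exists [::] => t; rewrite eqxx.
  exists (s ++ r) => t; rewrite mem_cat; apply: contraR; rewrite negb_or => /andP[ts tr].
  have /eqP f0 : f t == 0 by apply: contraNT ts => /sP.
  have /eqP h0 : h t == 0 by apply: contraNT tr => /rP.
  by rewrite -[(a *: f + h) t]/(a *: f t + h t) f0 h0 scaler0 addr0.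
pose F := submodType (submod_of hP).
have suppP (f : F) : exists s : seq M, uniq s /\ forall t, val f t != 0 -> t \in s.
  have /submod_ofP[s sP] := valP f; exists (undup s); split; first exact: undup_uniq.
  by move=> t; rewrite mem_undup; exact: sP.
pose supp f := projT1 (cid (suppP f)).
pose g (f : F) : M := \sum_(t <- supp f) (val f t : R) *: t.
have gE (f : F) u : uniq u -> (forall t, val f t != 0 -> t \in u) ->
    g f = \sum_(t <- u) (val f t : R) *: t.
  have [us sP] := projT2 (cid (suppP f)) => uu uP.
  have nz t : (val f t : R) *: t != 0 -> val f t != 0.
    by apply: contra => /eqP->; rewrite scale0r.
  by apply: big_support => // t /nz; [exact: sP|exact: uP].
have lg : linear g.
  move=> a f h; pose u := undup (supp f ++ supp h ++ supp (a *: f + h)).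
  have supp_u (e : F) : {subset supp e <= u} -> g e = \sum_(t <- u) (val e t : R) *: t.
    move=> eu; apply: gE => [|t et]; first exact: undup_uniq.
    by apply: eu; apply: (projT2 (cid (suppP e))).2.
  rewrite !supp_u; first 1 last.
  - by move=> t; rewrite mem_undup !mem_cat => ->; rewrite !orbT.
  - by move=> t; rewrite mem_undup !mem_cat => ->.
  - by move=> t; rewrite mem_undup !mem_cat => ->; rewrite !orbT.
  rewrite scaler_sumr -big_split; apply: eq_bigr => t _ /=.
  by rewrite scalerDl -scalerA.
have g_surj m : exists f, linear_of lg f = m.
  have dP : P (fun t => (t == m)%:R).
    by exists [:: m] => t; rewrite inE; apply: contraNT => /negPf->.
  have dS : (fun t => (t == m)%:R : R^o) \in submod_of hP by apply/submod_ofP.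
  exists (Submod dS); rewrite -[LHS]/(g _) (gE _ [:: m]) //.
    by rewrite big_seq1 /= eqxx scale1r.
  by move=> t /=; rewrite inE; apply: contraNT => /negPf->.
have [k kP] := Mproj _ _ (linear_of lg) idfun g_surj.
have lphi t : linear (fun x => val (k x) t : R^o).
  by move=> a x y; rewrite linearP.
exists (fun t => linear_of (lphi t)) => x.
have [us sP] := projT2 (cid (suppP (k x))).
exists (supp (k x)); split=> //.
by rewrite -[LHS](kP x).
Qed.

Hypothesis Rher : left_hereditary R.

(* Split off one functional at a time: its image is a left ideal, hence
   projective, so its kernel is a direct summand. *)
Lemma hereditary_projective n : forall M (phi : nat -> {linear M -> R^o}),
  (forall x, (forall i, (i < n)%N -> phi i x = 0) -> x = 0) -> projective_module M.
Proof.
elim: n => [|n IH] M phi phi0 A B g h g_surj.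
  have l0 : linear (fun _ : M => 0 : A) by move=> a x y; rewrite scaler0 addr0.
  by exists (linear_of l0) => x; rewrite (phi0 x) // !linear0.
have lK : submod_Prop (fun x => phi n x = 0).
  by split=> [|a u v hu hv]; rewrite ?linear0 // linearP hu hv scaler0 addr0.
have lI : submod_Prop (fun y => exists x, phi n x = y).
  split=> [|a _ _ [x <-] [y <-]]; first by exists 0; rewrite linear0.
  by exists (a *: x + y); rewrite linearP.
pose K := submod_of lK; pose I := submod_of lI.
have Kproj : projective_module (submodType K).
  apply: (IH _ (fun i => phi i \o val : {linear submodType K -> R^o})) => x x0.
  apply: val_inj; apply: phi0 => i; rewrite ltnS leq_eqVlt => /orP[/eqP->|/x0 //].
  exact/(submod_ofP lK)/(valP x).
have phiI x : phi n x \in I by apply/submod_ofP; exists x.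
have [phi' phi'E] := corestrict phiI.
have phi'_surj y : exists x, phi' x = y.
  have /submod_ofP[x xE] := valP y; exists x; apply: val_inj; rewrite phi'E.
  exact: xE.
have [s sP] := Rher idfun phi'_surj.
pose r := (idfun \- (s \o phi') : {linear M -> M}).
have rK x : r x \in K.
  by apply/submod_ofP; rewrite -phi'E /= linearB sP subrr.
have [r' r'E] := corestrict rK.
have [k1 k1P] := Rher (h \o s : {linear submodType I -> B}) g_surj.
have [k2 k2P] := Kproj _ _ g (h \o val : {linear submodType K -> B}) g_surj.
exists ((k1 \o phi') \+ (k2 \o r') : {linear M -> A}) => x /=.
rewrite linearD k1P k2P /= -linearD r'E /=.
by rewrite addrC subrK.
Qed.

(** * The injective envelope as the maximal quotient ring *)

Variable E : injEnvelope R^o.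
Local Notation i := (env_map E).

Lemma env_map1 (a : R) : i a = a *: i 1.
Proof. by rewrite -linearZ /= /GRing.scale /= mulr1. Qed.

Lemma env_essential_scale (x : E) : x != 0 -> exists a m : R, a *: x = i m /\ i m != 0.
Proof.
move=> x0; have hP : submod_Prop (fun y => exists a, y = a *: x).
  split=> [|a _ _ [b ->] [c ->]]; first by exists 0; rewrite scale0r.
  by exists (a * b + c); rewrite scalerDl scalerA.
have [|m [/submod_ofP[a aE] m0]] := (env_essential E).2 (submod_of hP).
  by exists x => //; apply/submod_ofP; exists 1; rewrite scale1r.
by exists a, m.
Qed.

(* The left annihilator of [m] is a direct summand because [R m] is projective. *)
Lemma hereditary_left_annihilator (m : R) : m != 0 ->
  exists f : R, [/\ f != 0, f * f = f & forall a, a * m = 0 -> a * f = 0].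
Proof.
move=> m0; have hP : submod_Prop (fun y : R^o => exists a, y = a * m).
  split=> [|a _ _ [b ->] [c ->]]; first by exists 0; rewrite mul0r.
  by exists (a * b + c); rewrite mulrDl -mulrA.
pose I := submod_of hP.
have lm : linear (fun a : R^o => (a : R) * m : R^o).
  by move=> a x y; rewrite mulrDl -mulrA.
have mI a : linear_of lm a \in I by apply/submod_ofP; exists a.
have [p pE] := corestrict mI.
have p_surj y : exists a, p a = y.
  have /submod_ofP[a aE] := valP y; exists a; apply: val_inj; rewrite pE.
  exact/esym.
have [k kP] := Rher idfun p_surj.
(* Here [a * f = k (p a)], so [R (1 - f)] is the left annihilator of [m]. *)
pose f : R := k (p 1).
have fm : f * m = m by rewrite -[LHS]pE kP /= pE -[LHS]/(1 * m) mul1r.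
have kM (a : R) : k (p a) = a * f.
  by rewrite -[RHS]/(a *: k (p 1)) -!linearZ /= /GRing.scale /= mulr1.
exists f; split.
- by apply: contraNneq m0 => f0; rewrite -fm f0 mul0r.
- by rewrite -kM kP.
- move=> a am; rewrite -kM.
  have -> : p a = 0 by apply: val_inj; rewrite pE.
  by rewrite linear0.
Qed.

(** Suppose [h] kills [R] but [h y = m] is nonzero in [R]. If [a y] lies in [R], then
    [a m = h (a y) = 0], so [a f = 0] for the idempotent [f] attached to [m]. Essentiality provides
    a nonzero multiple [a] of [f] with [a y] in [R], and then [a = a f = 0]. *)
Lemma hereditary_nonsingular (h : {linear E -> E}) :
  (forall a, h (i a) = 0) -> forall x, h x = 0.
Proof.
move=> hR x; apply: contrapT => /eqP /env_essential_scale[b [m [bm im0]]].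
pose y := b *: x; have hy : h y = i m by rewrite linearZ.
have [|f [f0 ff fP]] := @hereditary_left_annihilator m.
  by apply: contraNneq im0 => ->; rewrite linear0.
have J a c : a *: y = i c -> a * f = 0.
  move=> ay; apply: fP; apply: (env_essential E).1.
  by have := congr1 h ay; rewrite hR linearZ /= hy -linearZ linear0.
have [fy0|fy0] := eqVneq (f *: y) 0.
  by case/eqP: f0; rewrite -ff (J f 0) // linear0.
have [a [c [ac ic0]]] := env_essential_scale fy0.
case/eqP: ic0; rewrite -ac scalerA.
have := J (a * f) c; rewrite scalerA in ac; move=> /(_ ac).
by rewrite -mulrA ff => ->; rewrite scale0r.
Qed.

Lemma hereditary_Qmax (x : E) : x \in Qmax_submod E.
Proof. by apply/submod_ofP => h hR; exact: hereditary_nonsingular. Qed.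

Definition to_Qmax (x : E) : Qmax_of E := Submod (hereditary_Qmax x).

Lemma to_Qmax_val : cancel val to_Qmax.
Proof. by move=> x; exact: val_inj. Qed.

Lemma to_Qmax_linear (a : R) x y :
  to_Qmax (a *: x + y) = Qmax_inj E a * to_Qmax x + to_Qmax y.
Proof. by rewrite -Qmax_scaleE; exact: val_inj. Qed.

Lemma Qmax_projective : projective_module E <-> projective_module (Qmax_of E : lmodType R).
Proof.
have lt : linear (to_Qmax : E -> (Qmax_of E : lmodType R)).
  by move=> a x y; exact: val_inj.
split.
  apply: (@projective_retract _ _ (val : {linear (Qmax_of E : lmodType R) -> E}) (linear_of lt)).
  exact: to_Qmax_val.
by apply: (@projective_retract _ _ (linear_of lt) val).
Qed.

Lemma Qmax_ideal_submod (T : set (Qmax_of E)) :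
  left_ideal T -> submod_Prop (fun x => T (to_Qmax x)).
Proof.
move=> lT; split=> [|a u v Tu Tv]; last by rewrite to_Qmax_linear; exact: lT.2.
by have -> : to_Qmax 0 = 0; [exact: val_inj|case: lT].
Qed.

(** An extension of [f] to an endomorphism of [E] is right multiplication by its value at 1, which
    lies in [Qmax] because [Qmax] is all of [E]. *)
Lemma Qmax_extend (S : submodClosed E) (f : {linear submodType S -> E}) :
  exists p : Qmax_of E, forall x, f x = val (to_Qmax (val x) * p).
Proof.
have [h hP] := env_injective (f := (val : {linear submodType S -> E})) f val_inj.
exists (to_Qmax (h (i 1))) => x.
by rewrite -hP; apply/esym; exact: (@Qmax_mulE _ _ (to_Qmax (val x)) (to_Qmax (h (i 1))) h).
Qed.

Lemma Qmax_self_injective : self_injective (Qmax_of E).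
Proof.
move=> T f lT fT; pose S := submod_of (Qmax_ideal_submod lT).
have TS (x : submodType S) : T (to_Qmax (val x)).
  exact/(submod_ofP (Qmax_ideal_submod lT))/(valP x).
have lf : linear (fun x : submodType S => val (f (to_Qmax (val x))) : E).
  by move=> a x y; rewrite -[val (a *: x + y)]/(a *: val x + val y) to_Qmax_linear fT // -Qmax_scaleE.
have [p pP] := Qmax_extend (linear_of lf).
exists p => x Tx; apply: val_inj.
have xS : val x \in S by apply/submod_ofP; rewrite to_Qmax_val.
have xE : to_Qmax (val (Submod xS)) = x := to_Qmax_val x.
by have := pP (Submod xS); rewrite -[linear_of lf _]/(val (f (to_Qmax _))) xE.
Qed.

(** * Consequences of a projective envelope *)

Hypothesis Eproj : projective_module E.

(* Finitely many coordinates of [1] suffice to separate the points of the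
   essential extension [E] of [R]. *)
Lemma projective_sub_envelope (S : submodClosed E) : projective_module (submodType S).
Proof.
have [phi phiP] := projective_dual_basis Eproj.
have [s [_ sP s1]] := phiP (i 1).
pose psi n := phi (nth 0 s n) \o val : {linear submodType S -> R^o}.
apply: (@hereditary_projective (size s) _ psi) => x x0; apply: val_inj.
(* If [x] were nonzero, some [a *: x = i m] would be nonzero; expanding [i 1] writes [i m] as the
   sum of the [phi t (i m) *: t] over [s], all of which vanish. *)
apply: contrapT => /eqP /env_essential_scale[a [m [am /eqP]]]; apply.
rewrite env_map1 s1 scaler_sumr big1_seq // => t /andP[_ ts].
rewrite scalerA.
have -> : m * phi t (i 1) = phi t (i m) by rewrite (env_map1 m) linearZ.
have /= := x0 (index t s); rewrite index_mem nth_index // => /(_ ts) tx.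
by rewrite -am linearZ /= tx scaler0 scale0r.
Qed.

(** The functionals of an [R]-dual basis of [T] take values in [R], inside [E], so each is right
    multiplication by an element of [Qmax]. *)
Lemma Qmax_dual_basis (T : set (Qmax_of E)) : left_ideal T -> dual_basis T.
Proof.
move=> lT; pose hP := Qmax_ideal_submod lT; pose S := submod_of hP.
have [phi phiP] := projective_dual_basis (@projective_sub_envelope S).
have ex t : exists q : Qmax_of E, (~ T t -> q = 0) /\
    forall tS : val t \in S, forall x : submodType S,
      val (to_Qmax (val x) * q) = i (phi (Submod tS) x).
  have [tS|tS] := pselect (is_true (val t \in S)); last by exists 0.
  have [q qP] := Qmax_extend (i \o phi (Submod tS) : {linear submodType S -> E}).
  exists q; split=> [nT|tS' x]; last by rewrite -qP (bool_irrelevance tS' tS).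
  by case: nT; have /submod_ofP := tS; rewrite to_Qmax_val.
exists (fun t => projT1 (cid (ex t))); split.
  by move=> t; exact: (projT2 (cid (ex t))).1.
move=> x Tx.
have mem t : T t -> val t \in S by move=> Tt; apply/submod_ofP; rewrite to_Qmax_val.
pose x' : submodType S := Submod (mem x Tx).
have qE (t : submodType S) : val (x * projT1 (cid (ex (to_Qmax (val t))))) = i (phi t x').
  have := (projT2 (cid (ex (to_Qmax (val t))))).2 (valP t) x'.
  rewrite (to_Qmax_val x : to_Qmax (val x') = x) => ->.
  by congr (i (phi _ _)); exact: val_inj.
have [s [us sP xE]] := phiP x'.
have injS : injective (fun t : submodType S => to_Qmax (val t)).
  by move=> t u /(congr1 val) /= /val_inj.
exists [seq to_Qmax (val t) | t <- s]; split; first by rewrite map_inj_uniq.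
- move=> t xt; have [Tt|nT] := pselect (T t); last first.
    by move: xt; rewrite (projT2 (cid (ex t))).1 // mulr0 eqxx.
  have tE : t = to_Qmax (val (Submod (mem t Tt) : submodType S)) by rewrite /= to_Qmax_val.
  rewrite tE; apply/map_f/sP; apply: contraNneq xt => phi0.
  by apply/eqP/val_inj; rewrite [in LHS]tE qE phi0 linear0.
- apply: val_inj; rewrite -[LHS]/(val x') {1}xE big_map !raddf_sum.
  apply: eq_bigr => t _.
  have -> : x * projT1 (cid (ex (to_Qmax (val t)))) = Qmax_inj E (phi t x').
    by apply: val_inj; rewrite qE.
  by rewrite -Qmax_scaleE.
Qed.

End Modules.

Theorem theorem4p11 (R : pzRingType) :
  left_hereditary R ->
  (left_QF3plus R <-> semisimple_ring (Qmax R) /\ projective_module (Qmax R : lmodType R)).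
Proof.
move=> Rher; split=> [Eproj|[_]]; last by move/(Qmax_projective Rher).
split; last exact/(Qmax_projective Rher).
apply: semisimple_right_identity => T lT.
apply: direct_left_ideal lT; first exact: Qmax_self_injective.
exact: (@Qmax_dual_basis R Rher (injective_envelope R^o) Eproj).
Qed.
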